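(* For every integer $n\ge 1$, the first and last unique coefficients of row $n$ for $l=4$ are $$g_4(n,1)=g_4(n,2n-1)=\frac{(n^2+n)(n+2)}{6}.$$
   Context: For positive integers $l\ge 2$ and $n$, consider the expansion of $(x^{n-1}+x^{n-2}+\cdots+x+1)^l$, whose list of coefficients (of $x^0,x^1,\dots,x^{l(n-1)}$) is called a coefficient pattern. The unique coefficient pattern of row $n$ for the power $l$, denoted $U_n(l)$, consists of the coefficients of this pattern that are not already present in the patterns of the preceding (smaller) $n$. The comparison is made by position from either end of the list: the coefficients of $x^j$ with $j\le n-2$, and symmetrically those with $j\ge (l-1)(n-1)+1$, are the ones already present. So $U_n(l)$ is the ordered list of the coefficients of $x^j$ in $(x^{n-1}+\cdots+1)^l$ for $j=n-1,n,\dots,(l-1)(n-1)$. The $k$-th entry of this list, i.e. the coefficient of $x^{n+k-2}$ in $(x^{n-1}+\cdots+1)^l$, is denoted $g_l(n,k)$. For $l=4$ the list $U_n(4)$ has $2n-1$ entries, $k=1,\dots,2n-1$: $U_1(4)=(1)$, $U_2(4)=(4,6,4)$, $U_3(4)=(10,16,19,16,10)$, $U_4(4)=(20,31,40,44,40,31,20)$. *)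

(* Defs.v *)
From mathcomp Require Import all_boot all_order all_algebra.
From mathcomp Require Import zify.

Set Implicit Arguments.
Unset Strict Implicit.
Unset Printing Implicit Defensive.

Import GRing.Theory.
Local Open Scope ring_scope.

(* (x^{n-1} + ... + x + 1)^l; its coefficient list is the coefficient pattern
   of row n for the power l. *)
Definition pattern_poly (l n : nat) : {poly int} := (\sum_(i < n) 'X^i) ^+ l.

(* U_n(l).  Coefficients are compared with those of earlier rows by position
   from either end, which discards the x^j with j <= n - 2 or
   j >= (l - 1)(n - 1) + 1; what remains is j = n - 1, ..., (l - 1)(n - 1).
   (The upper bound of index_iota is exclusive.) *)
Definition unique_pattern (l n : nat) : seq int :=
  [seq (pattern_poly l n)`_j | j <- index_iota n.-1 (l.-1 * n.-1).+1].

(* g_l(n, k), with k counted from 1. *)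
Definition g (l n k : nat) : int := nth 0 (unique_pattern l n) k.-1.

Lemma size_unique_pattern4 (n : nat) :
  (0 < n)%N -> size (unique_pattern 4 n) = (2 * n - 1)%N.
Proof. by move=> hn; rewrite size_map size_iota; lia. Qed.

Lemma g_coef (l n k : nat) :
  (0 < n)%N -> (0 < k <= size (unique_pattern l n))%N ->
  g l n k = (pattern_poly l n)`_(n + k - 2).
Proof.
rewrite /g size_map => hn; rewrite size_iota => hk.
have hk' : (k.-1 < (l.-1 * n.-1).+1 - n.-1)%N by lia.
rewrite (nth_map 0%N) ?size_iota // nth_iota //.
by congr (_`__); lia.
Qed.

(* Main.v *)
Require Import Defs.
From mathcomp Require Import all_boot all_order all_algebra.
From mathcomp Require Import zify ring.
Import GRing.Theory.
Local Open Scope ring_scope.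

(** Below position [n] multiplying by [1 + x + ... + x^{n-1}] takes partial sums
    of coefficients, so by the hockey-stick identity the coefficient of [x^j] in
    the [l]-th power is ['C(j + l - 1, l - 1)] for [j < n].  The last unique
    coefficient equals the first by the reflection [i |-> n - 1 - i] of
    exponents. *)

Lemma hockey_stick (l j : nat) :
  (\sum_(i < j.+1) 'C(i + l, l) = 'C(j + l.+1, l.+1))%N.
Proof.
elim: j => [|j IHj]; first by rewrite big_ord1 !add0n !binn.
by rewrite big_ord_recr /= IHj addSnnS [in RHS]addSn binS.
Qed.

Lemma coef_geometric (n j : nat) :
  (\sum_(i < n) 'X^i : {poly int})`_j = (j < n)%N%:R.
Proof.
have -> : \sum_(i < n) 'X^i = \poly_(i < n) 1 :> {poly int}.
  by rewrite poly_def; apply: eq_bigr => i _; rewrite scale1r.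
by rewrite coef_poly; case: ifP.
Qed.

Lemma pattern_poly_coef_low (l n j : nat) :
  (j < n)%N -> (pattern_poly l.+1 n)`_j = 'C(j + l, l)%:R.
Proof.
elim: l j => [|l IHl] j ltjn.
  by rewrite /pattern_poly expr1 coef_geometric ltjn bin0.
rewrite /pattern_poly exprSr coefM -hockey_stick natr_sum.
apply: eq_bigr => i _; have ltin : (i < n)%N by have := ltn_ord i; lia.
rewrite [_`_i]IHl // coef_geometric.
by rewrite (leq_ltn_trans (leq_subr i j) ltjn) mulr1.
Qed.

(** Expanding the product chooses an exponent [f i] from each of the [l] factors. Counting choice
    functions makes the symmetry of coefficients a bijection argument. *)
Lemma pattern_poly_coefE (l n j : nat) :
  (pattern_poly l n)`_j =
  \sum_(f : {ffun 'I_l -> 'I_n}) (j == \sum_(i < l) f i)%N%:R.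
Proof.
have -> : pattern_poly l n = \prod_(i < l) \sum_(k < n) 'X^k.
  by rewrite prodr_const card_ord.
rewrite bigA_distr_bigA coef_sum; apply: eq_bigr => f _.
by rewrite -expr_sum coefXn.
Qed.

Lemma pattern_poly_coef_rev (l n j : nat) :
  (j <= l * n.-1)%N ->
  (pattern_poly l n)`_(l * n.-1 - j) = (pattern_poly l n)`_j.
Proof.
move=> le_j; rewrite !pattern_poly_coefE.
pose rev_ffun (f : {ffun 'I_l -> 'I_n}) := [ffun i => rev_ord (f i)].
have rev_ffunK : involutive rev_ffun.
  by move=> f; apply/ffunP=> i; rewrite !ffunE rev_ordK.
have sum_rev f : (\sum_(i < l) rev_ffun f i + \sum_(i < l) f i = l * n.-1)%N.
  rewrite -big_split -[l in RHS]card_ord -sum_nat_const.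
  by apply: eq_bigr => i _; rewrite ffunE; case: (f i) => k /=; lia.
(* Here [le_j] matters: it keeps the subtraction from truncating to 0. *)
have eq_rev f : (l * n.-1 - j == \sum_(i < l) rev_ffun f i)%N =
                (j == \sum_(i < l) f i)%N.
  by have := sum_rev f; lia.
by rewrite (reindex_inj (inv_inj rev_ffunK)); under eq_bigr do rewrite eq_rev.
Qed.

Theorem proposition2p4 (n : nat) (hn : (1 <= n)%N) :
  g 4 n 1%N = g 4 n (2 * n - 1)%N /\
  (g 4 n (2 * n - 1)%N)%:~R = (n%:R ^+ 2 + n%:R) * (n%:R + 2%:R) / 6%:R :> rat.
Proof.
have g_first : g 4 n 1 = 'C(n.+2, 3)%:R.
  rewrite g_coef ?size_unique_pattern4 //; last by lia.
  rewrite pattern_poly_coef_low; last by lia.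
  by congr ('C(_, _)%:R); lia.
have g_sym : g 4 n 1 = g 4 n (2 * n - 1).
  rewrite !g_coef ?size_unique_pattern4 //; try lia.
  (* The entries 1 and 2n - 1 sit at exponents n - 1 and 3(n - 1), which are mirror images since
     they add up to 4(n - 1). *)
  rewrite -pattern_poly_coef_rev; last by lia.
  by congr (_`__); lia.
split=> //; rewrite -g_sym g_first rmorph_nat.
(* The falling factorial (n + 2)(n + 1)n equals 3! times the binomial. This holds without division
   in [nat], so it is cast to [rat] before dividing by 6. *)
have := bin_ffact n.+2 3; rewrite !ffactnS ffactn0 /= => bin6.
have {bin6} : 'C(n.+2, 3)%:R * 6%:R = (n%:R + 2) * ((n%:R + 1) * n%:R) :> rat.
  by rewrite -natrM (_ : 6 = 3`!)%N // bin6 muln1 !natrM -addn2 -[n.+1]addn1 !natrD.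
by move=> bin6; apply: (canRL (mulfK _)) => //; rewrite bin6; ring.
Qed.
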